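(* Let $n\ge2$ and let $\zeta_n$ be a primitive $n$-th root of unity. Then: (i) for all $w,w'\in\widehat{\mathfrak H^1}$, $z_n(w*_q w')=z_n(w)z_n(w')$; (ii) let $\psi:\widehat{\mathfrak H^1}\to\widehat{\mathfrak H^1}$ be the $\mathcal C$-algebra anti-involution with $\psi(e_{\overline1})=-e_1$, $\psi(e_1)=-e_{\overline1}$, and $\psi(e_k)=(-1)^k\sum_{j=2}^k\binom{k-2}{j-2}\hbar^{k-j}e_j$ for $k\ge2$. Then for all $w,w'\in\widehat{\mathfrak H^1}$, $z_n(w\sqcup\!\sqcup_q w')=z_n(\psi(w)w')$.
   Context: Let $\hbar$ be a formal variable, $\mathcal{C}=\mathbb{Q}[\hbar,\hbar^{-1}]$, and $\mathfrak{H}=\mathcal{C}\langle \mathbf{a},\mathbf{b}\rangle$ the non-commutative polynomial ring over $\mathcal{C}$. Let $\widehat{\mathbb{N}}=\{\overline{1}\}\sqcup\mathbb{N}$, $\overline1$ a new symbol. Put $e_{\overline{1}}=\mathbf{a}\mathbf{b}$ and $e_k=\mathbf{a}^{k-1}(\mathbf{a}+\hbar)\mathbf{b}$ for $k\ge 1$. Let $\widehat{\mathfrak{H}^1}$ be the $\mathcal{C}$-subalgebra generated freely by $\{e_k\}_{k\in\widehat{\mathbb{N}}}$; an index is a tuple $\mathbf k=(k_1,\dots,k_r)$, $r\ge0$, of elements of $\widehat{\mathbb N}$, $e_{\mathbf k}=e_{k_1}\cdots e_{k_r}$, $e_\emptyset=1$, and $\{e_{\mathbf k}\}$ over all indices is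 a $\mathcal C$-basis of $\widehat{\mathfrak H^1}$. Stuffle product: let $\mathfrak{z}$ be the $\mathcal{C}$-span of $\{e_k\}$ and $\circ_q$ the symmetric $\mathcal{C}$-bilinear map with $e_{\overline1}\circ_q e_{\overline1}=e_2-\hbar e_{\overline1}$, $e_{\overline1}\circ_q e_k=e_{k+1}$, $e_k\circ_q e_l=e_{k+l}+\hbar e_{k+l-1}$ ($k,l\ge1$). $*_q$ is the $\mathcal{C}$-bilinear product on $\widehat{\mathfrak{H}^1}$ with $1*_q w=w*_q1=w$ and $(e_kw)*_q(e_lw')=e_k(w*_q e_lw')+e_l(e_kw*_q w')+(e_k\circ_q e_l)(w*_q w')$. Shuffle product: $\sqcup\!\sqcup_q$ is the $\mathcal{C}$-bilinear product on $\mathfrak H$ with $1\sqcup\!\sqcup_q w=w\sqcup\!\sqcup_q 1=w$, $(\mathbf a w)\sqcup\!\sqcup_q(\mathbf a w')=\mathbf a\big((\mathbf a w)\sqcup\!\sqcup_q w'+w\sqcup\!\sqcup_q(\mathbf a w')+\hbar\, w\sqcup\!\sqcup_q w'\big)$, $(\mathbf b w)\sqcup\!\sqcup_q w'=w\sqcup\!\sqcup_q(\mathbf b w')=\mathbf b(w\sqcup\!\sqcup_q w')$; $\widehat{\mathfrak H^1}$ is closed under it. For $m\ge1$ let $[m]=(1-q^m)/(1-q)$, $F_{\overline1}(m)=q^m/[m]$, $F_k(m)=q^{(k-1)m}/[m]^k$ ($k\ge1$). For an index $\mathbf k=(k_1,\dots,k_r)$ put $z_n(\mathbf k;\zeta_n)=\sum_{n>m_1>\cdots>m_r\ge1}\prod_{j=1}^rF_{k_j}(m_j)\big|_{q=\zeta_n}$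 (empty sum $=0$ if $r\ge n$; $z_n(\emptyset;\zeta_n)=1$). Regard $\mathbb C$ as a $\mathcal C$-module with $\hbar$ acting as multiplication by $1-\zeta_n$, and let $z_n:\widehat{\mathfrak H^1}\to\mathbb C$ be the $\mathcal C$-linear map with $z_n(e_{\mathbf k})=z_n(\mathbf k;\zeta_n)$ for every index $\mathbf k$. *)

(* Defs.v *)
From HB Require Import structures.
From mathcomp Require Import all_boot all_order all_algebra.
From mathcomp Require Import fraction.
From mathcomp Require Import finmap monalg complex.
From mathcomp Require Import boolp reals.
From mathcomp Require Import ring.

Set Implicit Arguments.
Unset Strict Implicit.
Unset Printing Implicit Defensive.

Import Order.TTheory GRing.Theory Num.Theory.

Local Open Scope ring_scope.

(* Q[hbar, hbar^-1] is the subring of the fractions p / hbar^n in Q(hbar),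
   hbar being 'X. *)

Definition is_laurent : {pred {fraction {poly rat}}} := fun x =>
  `[< exists p : {poly rat} * nat, x = tofrac p.1 / tofrac 'X ^+ p.2 >].

Record laurent := Laurent {
  laurent_val : {fraction {poly rat}};
  _ : is_laurent laurent_val }.

HB.instance Definition _ := [isSub for laurent_val].
HB.instance Definition _ := [Choice of laurent by <:].

Lemma subf_pow_div (F : fieldType) (p q x : F) (n m : nat) : x != 0 ->
  p / x ^+ n - q / x ^+ m = (p * x ^+ m - q * x ^+ n) / x ^+ (n + m).
Proof. by move=> x0; rewrite exprD; field; rewrite !expf_neq0. Qed.

Lemma mulf_pow_div (F : fieldType) (p q x : F) (n m : nat) : x != 0 ->
  (p / x ^+ n) * (q / x ^+ m) = (p * q) / x ^+ (n + m).
Proof. by move=> x0; rewrite exprD; field; rewrite !expf_neq0. Qed.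

Lemma div_eq_cross (F : fieldType) (p q x y : F) : x != 0 -> y != 0 ->
  p / x = q / y -> p * y = q * x.
Proof. by move=> x0 y0 /eqP; rewrite eqr_div // => /eqP. Qed.

Lemma tofracX_neq0 n : tofrac ('X : {poly rat}) ^+ n != 0.
Proof. by rewrite expf_neq0 // tofrac_eq0 polyX_eq0. Qed.

Fact is_laurent_subring : subring_closed is_laurent.
Proof.
split.
- by apply/asboolP; exists (1, 0%N); rewrite /= expr0 divr1 tofrac1.
- move=> x y /asboolP[[p n] ->] /asboolP[[q m] ->]; apply/asboolP.
  exists (p * 'X ^+ m - q * 'X ^+ n, (n + m)%N) => /=.
  by rewrite subf_pow_div ?(tofracX_neq0 1) // tofracB !tofracM !tofracXn.
- move=> x y /asboolP[[p n] ->] /asboolP[[q m] ->]; apply/asboolP.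
  exists (p * q, (n + m)%N) => /=.
  by rewrite mulf_pow_div ?(tofracX_neq0 1) // tofracM.
Qed.

HB.instance Definition _ :=
  GRing.isSubringClosed.Build {fraction {poly rat}} is_laurent
    is_laurent_subring.
HB.instance Definition _ := [SubChoice_isSubComNzRing of laurent by <:].

Lemma is_laurent_hbar : is_laurent (tofrac 'X).
Proof. by apply/asboolP; exists ('X, 0%N); rewrite /= expr0 divr1. Qed.

Lemma is_laurent_hbarV : is_laurent (tofrac 'X)^-1.
Proof. by apply/asboolP; exists (1, 1%N); rewrite /= expr1 tofrac1 mul1r. Qed.

Definition hbar : laurent := Laurent is_laurent_hbar.
Definition hbarV : laurent := Laurent is_laurent_hbarV.

Lemma hbarK : hbar * hbarV = 1.
Proof.
by apply: val_inj; rewrite /= mulfV // -[tofrac _]expr1 tofracX_neq0.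
Qed.

Lemma laurentP (x : laurent) :
  exists p : {poly rat} * nat, val x = tofrac p.1 / tofrac 'X ^+ p.2.
Proof. exact/asboolP/(valP x). Qed.

(* For h != 0, the Q-algebra morphism with hbar |-> h: the value does not
   depend on the representation p / hbar^n that is chosen (laurent_evE). *)
Definition laurent_ev (F : numFieldType) (h : F) (x : laurent) : F :=
  let p := projT1 (cid (laurentP x)) in
  (map_poly ratr p.1).[h] / h ^+ p.2.

Section LaurentEval.
Variables (F : numFieldType) (h : F).
Hypothesis h0 : h != 0.

Lemma laurent_evE (x : laurent) (p : {poly rat}) (n : nat) :
  val x = tofrac p / tofrac 'X ^+ n ->
  laurent_ev h x = (map_poly ratr p).[h] / h ^+ n.
Proof.
rewrite /laurent_ev; case: cid => [[q m] /= ->] E.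
have Xn := tofracX_neq0 n; have Xm := tofracX_neq0 m.
have /eqP : tofrac (q * 'X ^+ n) = tofrac (p * 'X ^+ m).
  by rewrite !tofracM !tofracXn (div_eq_cross Xm Xn E).
rewrite tofrac_eq => /eqP E2.
have := congr1 (fun r => (map_poly ratr r).[h]) E2.
rewrite !rmorphM /= !map_polyXn !hornerM !hornerXn => E3.
by apply/eqP; rewrite eqr_div ?expf_neq0 // E3.
Qed.

Lemma laurent_ev1 : laurent_ev h 1 = 1.
Proof.
by rewrite (@laurent_evE _ 1 0) ?rmorph1 ?hornerC ?expr0 ?divr1 ?tofrac1.
Qed.

Lemma laurent_evB : {morph laurent_ev h : x y / x - y}.
Proof.
move=> x y; have [[p n] /= Ex] := laurentP x; have [[q m] /= Ey] := laurentP y.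
rewrite (laurent_evE Ex) (laurent_evE Ey).
rewrite (@laurent_evE _ (p * 'X ^+ m - q * 'X ^+ n) (n + m)).
  rewrite rmorphB !rmorphM /= !map_polyXn hornerD hornerN !hornerM !hornerXn.
  by rewrite subf_pow_div.
rewrite [LHS]/(laurent_val x - laurent_val y) Ex Ey.
rewrite [LHS]subf_pow_div ?(tofracX_neq0 1) //.
by rewrite tofracB !tofracM !tofracXn.
Qed.

Lemma laurent_evM : {morph laurent_ev h : x y / x * y}.
Proof.
move=> x y; have [[p n] /= Ex] := laurentP x; have [[q m] /= Ey] := laurentP y.
rewrite (laurent_evE Ex) (laurent_evE Ey).
rewrite (@laurent_evE _ (p * q) (n + m)).
  by rewrite rmorphM /= hornerM mulf_pow_div.
rewrite [LHS]/(laurent_val x * laurent_val y) Ex Ey.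
by rewrite [LHS]mulf_pow_div ?(tofracX_neq0 1) // tofracM.
Qed.

Lemma laurent_ev_hbar : laurent_ev h hbar = h.
Proof.
by rewrite (@laurent_evE _ 'X 0) ?map_polyX ?hornerX ?expr0 ?divr1.
Qed.

End LaurentEval.

Notation free_alg I := {malg laurent[{fmonom I}]}.

Definition word (I : choiceType) (u : seq I) : free_alg I := << FMonom u >>.

Definition lin_ext (I : choiceType) (V : lmodType laurent) (f : seq I -> V)
    (x : free_alg I) : V :=
  \sum_(u <- msupp x) x@_u *: f u.

Definition bilin_ext (I : choiceType) (V : lmodType laurent)
    (f : seq I -> seq I -> V) (x y : free_alg I) : V :=
  lin_ext (fun u => lin_ext (f u) y) x.

Lemma malgU_scale (K : choiceType) (R : nzRingType) (c : R) (k : K) :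
  << c *g k >> = c *: (<< k >> : {malg R[K]}).
Proof. by apply/malgP=> k'; rewrite mcoeffZ !mcoeffU mulr_natr. Qed.

Section LinExt.
Variables (I : choiceType).

Lemma word_nil : word [::] = 1 :> free_alg I.
Proof. by rewrite /word -fmoneE. Qed.

Lemma wordM (u v : seq I) : word u * word v = word (u ++ v).
Proof. by rewrite malgM_def fgmulUU mulr1 [X in << X >>]fmmulE. Qed.

Lemma word_ind (P : free_alg I -> Prop) :
  P 0 -> (forall c u x, P x -> P (c *: word u + x)) -> forall x, P x.
Proof.
move=> P0 PS x; rewrite (monalgE x).
elim: (enum_fset _) => [|[u] r IH]; first by rewrite big_nil.
by rewrite big_cons malgU_scale; apply: PS.
Qed.

Variable V : lmodType laurent.

Lemma lin_extEw (f : seq I -> V) (d : {fset {fmonom I}}) (x : free_alg I) :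
  (msupp x `<=` d)%fset -> lin_ext f x = \sum_(u <- d) x@_u *: f u.
Proof.
move=> le; rewrite [LHS](big_fset_incl _ le) => //= u _ /mcoeff_outdom ->.
by rewrite scale0r.
Qed.

Fact lin_ext_is_linear (f : seq I -> V) : linear (lin_ext f).
Proof.
move=> c x y; pose d := (msupp x `|` msupp y `|` msupp (c *: x + y))%fset.
rewrite !(@lin_extEw _ d) ?fsubsetUr //.
- rewrite scaler_sumr -big_split /=; apply: eq_bigr => u _.
  by rewrite mcoeffD mcoeffZ scalerDl scalerA.
- by apply/fsubsetP=> k kx; rewrite !in_fsetE kx orbT.
- by apply/fsubsetP=> k kx; rewrite !in_fsetE kx.
Qed.

HB.instance Definition _ (f : seq I -> V) :=
  GRing.isLinear.Build laurent (free_alg I) V *:%R (lin_ext f)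
    (lin_ext_is_linear f).

Lemma lin_ext_word (f : seq I -> V) u : lin_ext f (word u) = f u.
Proof.
rewrite (@lin_extEw _ [fset FMonom u]%fset) ?msuppU_le //.
by rewrite big_seq_fset1 mcoeffUU scale1r.
Qed.

Lemma bilin_ext_linearl (f : seq I -> seq I -> V) y :
  linear (bilin_ext f ^~ y).
Proof. by move=> c x x'; rewrite /bilin_ext linearP. Qed.

Lemma bilin_ext_linearr (f : seq I -> seq I -> V) x :
  linear (bilin_ext f x).
Proof.
move=> c y y'; rewrite /bilin_ext /lin_ext scaler_sumr -big_split /=.
apply: eq_bigr => u _; rewrite -!/(lin_ext _ _) linearP scalerDr !scalerA.
by rewrite (mulrC x@_u c).
Qed.

Lemma bilin_ext_word (f : seq I -> seq I -> V) u v :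
  bilin_ext f (word u) (word v) = f u v.
Proof. by rewrite /bilin_ext !lin_ext_word. Qed.

End LinExt.

Notation la := true (only parsing).
Notation lb := false (only parsing).
Notation Halg := (free_alg bool).

Definition gen_a : Halg := word [:: la].
Definition gen_b : Halg := word [:: lb].

(* None is \overline 1 and Some k is the integer k + 1. *)
Definition Nhat := option nat.
Definition bar1 : Nhat := None.
Definition ix (k : nat) : Nhat := Some k.-1.

(* The subalgebra of Halg generated by the e_k is the image of the free algebra
   on Nhat under toH; toH_inj shows that the e_k generate it freely. *)
Notation Hhat1 := (free_alg Nhat).

Definition eh (i : Nhat) : Hhat1 := word [:: i].

Definition e_in_H (i : Nhat) : Halg :=
  match i with
  | None => gen_a * gen_b
  | Some j => let k := j.+1 in gen_a ^+ (k - 1) * (gen_a + hbar%:A) * gen_b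
  end.

Definition toH : Hhat1 -> Halg := lin_ext (fun ks => \prod_(i <- ks) e_in_H i).

Definition circ_q (x y : Nhat) : Hhat1 :=
  match x, y with
  | None, None => eh (ix 2) - hbar *: eh bar1
  | None, Some j | Some j, None => let k := j.+1 in eh (ix (k + 1))
  | Some i, Some j =>
      let k := i.+1 in let l := j.+1 in
      eh (ix (k + l)) + hbar *: eh (ix (k + l - 1))
  end.

Fixpoint stuffle_word (u : seq Nhat) : seq Nhat -> Hhat1 :=
  fix stuffle_u (v : seq Nhat) : Hhat1 :=
    match u, v with
    | [::], _ => word v
    | _, [::] => word u
    | k :: u', l :: v' =>
        eh k * stuffle_word u' v + eh l * stuffle_u v'
        + circ_q k l * stuffle_word u' v'
    end.

Definition stuffle : Hhat1 -> Hhat1 -> Hhat1 := bilin_ext stuffle_word.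

Fixpoint shuffle_word (u : seq bool) : seq bool -> Halg :=
  fix shuffle_u (v : seq bool) : Halg :=
    match u, v with
    | [::], _ => word v
    | _, [::] => word u
    | lb :: u', _ => gen_b * shuffle_word u' v
    | la :: _, lb :: v' => gen_b * shuffle_u v'
    | la :: u', la :: v' =>
        gen_a * (shuffle_u v' + shuffle_word u' v
                 + hbar *: shuffle_word u' v')
    end.

Definition shuffleH : Halg -> Halg -> Halg := bilin_ext shuffle_word.

(* toH (ab_elt j) is a^j b (toH_ab_elt), from e_k = a^k b + hbar a^(k-1) b for
   k >= 1 and e_(bar1) = ab. *)
Fixpoint ab_elt (j : nat) : Hhat1 :=
  match j with
  | 0 => hbarV *: (eh (ix 1) - eh bar1)
  | 1 => eh bar1
  | j'.+1 => eh (ix j) - hbar *: ab_elt j'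
  end.

Fixpoint ofH_word (j : nat) (u : seq bool) : Hhat1 :=
  match u with
  | [::] => (j == 0%N)%:R
  | la :: u' => ofH_word j.+1 u'
  | lb :: u' => ab_elt j * ofH_word 0 u'
  end.

(* A left inverse of toH, sending the words that end with a to 0. *)
Definition ofH : Halg -> Hhat1 := lin_ext (ofH_word 0).

(* The product of Halg read in Hhat1: toH_shuffle shows that toH carries it to
   shuffleH, that is, that the image of toH is closed under shuffleH. *)
Definition shuffle (w w' : Hhat1) : Hhat1 := ofH (shuffleH (toH w) (toH w')).

Definition psi_gen (i : Nhat) : Hhat1 :=
  match i with
  | None => - eh (ix 1)
  | Some 0 => - eh bar1
  | Some (_.+1 as i') =>
      let k := i'.+1 in
      (-1) ^+ k *: \sum_(2 <= j < k.+1)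
        ('C(k - 2, j - 2)%:R * hbar ^+ (k - j)) *: eh (ix j)
  end.

Definition psi : Hhat1 -> Hhat1 :=
  lin_ext (fun ks => \prod_(i <- rev ks) psi_gen i).

Section Values.
Variable F : numFieldType.
Implicit Types (q zeta : F) (n m : nat).

Definition qnat q m : F := (1 - q ^+ m) / (1 - q).

Definition Fq q (i : Nhat) m : F :=
  match i with
  | None => q ^+ m / qnat q m
  | Some j => let k := j.+1 in q ^+ ((k - 1) * m) / qnat q m ^+ k
  end.

Definition zval n zeta (ks : seq Nhat) : F :=
  \sum_(m : {ffun 'I_(size ks) -> 'I_n} |
      [forall j, (0 < m j)%N] &&
      [forall i : 'I_(size ks), forall j : 'I_(size ks), (i < j)%N ==> (m j < m i)%N])
    \prod_(j < size ks) Fq zeta (nth bar1 ks j) (m j).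

Definition zn n zeta (w : Hhat1) : F :=
  mmap (laurent_ev (1 - zeta)) (fun ks : {fmonom Nhat} => zval n zeta ks) w.

End Values.

Lemma malg_scaleAr (K : monomType) (R : comNzRingType) (c : R)
  (x y : {malg R[K]}) : c *: (x * y) = x * (c *: y).
Proof.
suff cC : c%:MP * x = x * c%:MP.
  by rewrite -!mul_malgC !mulrA cC.
rewrite (monalgE x) mulr_sumr mulr_suml; apply: eq_bigr => k _.
by rewrite !malgM_def !fgmulUU mul1m mulm1 mulrC.
Qed.

Lemma mulr_affine (R : pzRingType) (A : lalgType R) (c : R) (a b x : A) :
  (a + c *: b) * x = a * x + c *: (b * x).
Proof. by rewrite mulrDl scalerAl. Qed.

Lemma word_eq (I : choiceType) (V : lmodType laurent) (f g : free_alg I -> V) :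
  linear f -> linear g -> (forall u, f (word u) = g (word u)) -> f =1 g.
Proof.
move=> lf lg fg; apply: word_ind => [|c u x IH]; last by rewrite lf lg fg IH.
have lin0 (k : free_alg I -> V) : linear k -> k 0 = 0.
  move=> lk; have := lk (-1) 0 0; rewrite [-1 *: 0 + 0]addr0 scaler0 => ->.
  by rewrite scaleN1r addNr.
by rewrite !lin0.
Qed.

Lemma word_eq2 (I : choiceType) (V : lmodType laurent)
    (f g : free_alg I -> free_alg I -> V) :
  (forall y, linear (f^~ y)) -> (forall x, linear (f x)) ->
  (forall y, linear (g^~ y)) -> (forall x, linear (g x)) ->
  (forall u v, f (word u) (word v) = g (word u) (word v)) -> f =2 g.
Proof.
move=> lfl lfr lgl lgr fg x y.
apply: (word_eq (lfl y) (lgl y)) => u.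
exact: (word_eq (lfr _) (lgr _)).
Qed.

Fact toH_linear : linear toH. Proof. exact: linearP. Qed.
HB.instance Definition _ :=
  GRing.isLinear.Build laurent Hhat1 Halg *:%R toH toH_linear.

Fact ofH_linear : linear ofH. Proof. exact: linearP. Qed.
HB.instance Definition _ :=
  GRing.isLinear.Build laurent Halg Hhat1 *:%R ofH ofH_linear.

Lemma ofHD : {morph ofH : x y / x + y}. Proof. exact: linearD. Qed.
Lemma ofHZ c : {morph ofH : x / c *: x}. Proof. exact: linearZ. Qed.

Fact psi_linear : linear psi. Proof. exact: linearP. Qed.
HB.instance Definition _ :=
  GRing.isLinear.Build laurent Hhat1 Hhat1 *:%R psi psi_linear.

Lemma toH_word ks : toH (word ks) = \prod_(i <- ks) e_in_H i.
Proof. exact: lin_ext_word. Qed.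

Lemma toH1 : toH 1 = 1.
Proof. by rewrite -word_nil toH_word big_nil. Qed.

Lemma toHM : {morph toH : x y / x * y}.
Proof.
apply: word_eq2 => [y c x x'|x c y y'|y c x x'|x c y y'|u v].
- by rewrite mulrDl -scalerAl linearP.
- by rewrite mulrDr -malg_scaleAr linearP.
- by rewrite linearP mulrDl -scalerAl.
- by rewrite linearP mulrDr -malg_scaleAr.
by rewrite wordM !toH_word big_cat.
Qed.

Lemma toH_eh i : toH (eh i) = e_in_H i.
Proof. by rewrite toH_word big_seq1. Qed.

Lemma gen_aX j : gen_a ^+ j = word (nseq j la).
Proof. by elim: j => [|j IH]; rewrite ?expr0 ?word_nil // exprS IH wordM. Qed.

Lemma e_in_HS j :
  e_in_H (Some j) =
  word (rcons (nseq j.+1 la) lb) + hbar *: word (rcons (nseq j la) lb).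
Proof.
rewrite /= subn1 mulrDr mulrDl -malg_scaleAr mulr1 -scalerAl -exprSr !gen_aX.
by rewrite !wordM !cats1.
Qed.

Lemma toH_ab_elt j : toH (ab_elt j) = word (rcons (nseq j la) lb).
Proof.
have ab : e_in_H bar1 = word (rcons (nseq 1 la) lb) by rewrite /= wordM.
elim: j => [|[|j] IH].
- have E0 : e_in_H (ix 1) - e_in_H bar1 = hbar *: word [:: lb].
    by rewrite ab e_in_HS addrC addKr.
  transitivity (hbarV *: (e_in_H (ix 1) - e_in_H bar1)).
    by rewrite -(toH_eh (ix 1)) -(toH_eh bar1) -linearB -linearZ.
  by rewrite E0 scalerA [hbarV * _]mulrC hbarK scale1r.
- by rewrite toH_eh ab.
- rewrite [ab_elt _]/(eh (ix j.+2) - hbar *: ab_elt j.+1).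
  by rewrite linearB linearZ /= IH toH_eh e_in_HS addrK.
Qed.

Lemma ofH_word_nseq i j u : ofH_word j (nseq i la ++ u) = ofH_word (i + j) u.
Proof. by elim: i j => [|i IH] j //=; rewrite IH addnS. Qed.

Lemma ofHE u : ofH (word u) = ofH_word 0 u.
Proof. exact: lin_ext_word. Qed.

Lemma ofH_ab j x : ofH (word (rcons (nseq j la) lb) * x) = ab_elt j * ofH x.
Proof.
apply: (word_eq (f := fun x => ofH (_ * x)) (g := fun x => _ * ofH x)).
- by move=> c y y'; rewrite mulrDr -malg_scaleAr linearP.
- by move=> c y y'; rewrite linearP mulrDr -malg_scaleAr.
by move=> u; rewrite wordM !ofHE cat_rcons ofH_word_nseq addn0.
Qed.

Lemma toHK : cancel toH ofH.
Proof.
apply: (word_eq (f := ofH \o toH) (g := idfun)) => [c x y|//|ks].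
  by rewrite /= !linearP.
rewrite /=; elim: ks => [|i ks IHk].
  by rewrite word_nil toH1 -word_nil ofHE.
rewrite -[i :: ks]/([:: i] ++ ks) -wordM toHM -/(eh i) toH_eh.
case: i => [j|]; last first.
  have -> : e_in_H None = word (rcons (nseq 1 la) lb) by rewrite /= wordM.
  by rewrite ofH_ab IHk.
rewrite e_in_HS; move: (toH _) IHk => X IHk.
have -> : ofH ((word (rcons (nseq j.+1 la) lb) +
                hbar *: word (rcons (nseq j la) lb)) * X) =
          (ab_elt j.+1 + hbar *: ab_elt j) * ofH X.
  have EH A B a b : ofH A = a -> ofH B = b ->
      ofH (A + hbar *: B) = a + hbar *: b.
    by move=> <- <-; rewrite ofHD ofHZ.
  rewrite mulr_affine (EH _ _ _ _ (ofH_ab j.+1 X) (ofH_ab j X)).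
  by rewrite (mulr_affine hbar (ab_elt j.+1) (ab_elt j)).
rewrite IHk; congr (_ * _).
case: j => [|j]; last by rewrite [ab_elt _]/(eh (ix j.+2) - hbar *: ab_elt j.+1) subrK.
by rewrite /= scalerA hbarK scale1r addrC subrK.
Qed.

Lemma toH_inj : injective toH.
Proof. exact: can_inj toHK. Qed.

Inductive span_words (P : pred (seq bool)) : Halg -> Prop :=
| span_words0 : span_words P 0
| span_wordsS c u x : P u -> span_words P x -> span_words P (c *: word u + x).

Lemma span_wordsD P x y :
  span_words P x -> span_words P y -> span_words P (x + y).
Proof.
move=> Px Py; elim: Px => [|c u z Pu _ IH]; first by rewrite add0r.
by rewrite -addrA; apply: span_wordsS.
Qed.

Lemma span_wordsZ P c x : span_words P x -> span_words P (c *: x).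
Proof.
elim=> [|d u z Pu _ IH]; first by rewrite scaler0; apply: span_words0.
by rewrite scalerDr scalerA; apply: span_wordsS.
Qed.

Lemma span_words_word (P : pred (seq bool)) u : P u -> span_words P (word u).
Proof.
by move=> Pu; rewrite -[word u]addr0 -[word u]scale1r; apply/span_wordsS/span_words0.
Qed.

Lemma span_words_lin (P Q : pred (seq bool)) (f : Halg -> Halg) x : linear f ->
  (forall u, P u -> span_words Q (f (word u))) ->
  span_words P x -> span_words Q (f x).
Proof.
move=> lf PQ; elim=> [|c u z Pu _ IH].
  have -> : f 0 = 0.
    have := lf (-1) 0 0; rewrite scaleN1r addNr => ->.
    by rewrite scaleN1r addNr.
  exact: span_words0.
by rewrite lf; apply/span_wordsD/IH/span_wordsZ/PQ.
Qed.

Lemma mulr_is_linear (x : Halg) : linear ( *%R x).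
Proof. by move=> c y z; rewrite mulrDr malg_scaleAr. Qed.

Definition ends_b (u : seq bool) := last la u == lb.
Definition nil_or_ends_b (u : seq bool) := (u == [::]) || ends_b u.

Lemma span_genM (P : pred (seq bool)) c x : (forall u, P u -> P (c :: u)) ->
  span_words P x -> span_words P (word [:: c] * x).
Proof.
move=> Pc; apply: span_words_lin; first exact: mulr_is_linear.
by move=> u Pu; rewrite wordM; apply/span_words_word/Pc.
Qed.

Lemma shuffle_ends_b u v :
  ends_b u -> ends_b v -> span_words ends_b (shuffle_word u v).
Proof.
have bP w : ends_b w -> ends_b (lb :: w) by case: w.
have aP w : ends_b w -> ends_b (la :: w) by case: w.
elim: u v => [//|c u IHu]; elim=> [//|d v IHv] uP vP.
case: c uP IHv => uP IHv; last first.
  rewrite [shuffle_word _ _]/(gen_b * shuffle_word u (d :: v)).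
  apply: span_genM => //; case: u uP IHu {IHv} => [|c u] uP IHu.
    by apply: span_words_word.
  exact: IHu.
have {}uP : ends_b u by case: u uP {IHu IHv}.
have aup := aP _ uP.
case: d vP => vP; last first.
  rewrite [shuffle_word _ _]/(gen_b * shuffle_word (la :: u) v).
  apply: span_genM => //; case: v vP IHv => [|d v] vP IHv.
    by apply: span_words_word.
  exact: IHv.
have {}vP : ends_b v by case: v vP {IHv}.
rewrite [shuffle_word _ _]/(gen_a * (shuffle_word (la :: u) v +
  shuffle_word u (la :: v) + hbar *: shuffle_word u v)).
apply: span_genM => //; apply: span_wordsD; last exact/span_wordsZ/IHu.
by apply: span_wordsD; [apply: IHv | apply/IHu/aP].
Qed.

Lemma shuffle_nil_or_ends_b u v : nil_or_ends_b u -> nil_or_ends_b v ->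
  span_words nil_or_ends_b (shuffle_word u v).
Proof.
move=> /orP[/eqP->|uP] vP.
  have -> : shuffle_word [::] v = word v by case: v {vP}.
  exact: span_words_word.
case/orP: vP => [/eqP->|vP].
  have -> : shuffle_word u [::] = word u by case: u {uP} => [|[]].
  by apply: span_words_word; rewrite /nil_or_ends_b uP orbT.
apply: (span_words_lin (f := idfun) (P := ends_b)) => //.
  by move=> w wP; apply: span_words_word; rewrite /nil_or_ends_b wP orbT.
exact: shuffle_ends_b.
Qed.

Lemma span_toH x : span_words nil_or_ends_b (toH x).
Proof.
elim/word_ind: x => [|c ks x IH]; first by rewrite linear0; apply: span_words0.
rewrite linearP /=; apply: span_wordsD => //; apply: span_wordsZ.
rewrite toH_word; elim: ks => [|i ks IHk].
  by rewrite big_nil -word_nil; apply: span_words_word.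
have ab j : span_words nil_or_ends_b
    (word (rcons (nseq j la) lb) * \prod_(k <- ks) e_in_H k).
  apply: span_words_lin IHk; first exact: mulr_is_linear.
  move=> u uP; rewrite wordM; apply: span_words_word.
  rewrite /nil_or_ends_b /ends_b last_cat last_rcons.
  by case/orP: uP => [/eqP->|]; [rewrite orbT | case: u => // a u; rewrite /ends_b /= => ->; rewrite orbT].
rewrite big_cons; case: i => [j|]; last by rewrite /= wordM; apply: (ab 1%N).
by rewrite e_in_HS mulrDl -scalerAl; apply/span_wordsD/span_wordsZ.
Qed.

Lemma span_in_toH x : span_words nil_or_ends_b x -> exists y, x = toH y.
Proof.
elim=> [|c u {}x uP _ [y ->]]; first by exists 0; rewrite linear0.
suff [z ->] : exists z, word u = toH z by exists (c *: z + y); rewrite linearP.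
have gen j v : nil_or_ends_b v -> (v = [::] -> j = 0%N) ->
    exists z, word (nseq j la ++ v) = toH z.
  elim: v j => [|d v IHv] j vP j0.
    by exists 1; rewrite j0 //= word_nil toH1.
  case: d vP j0 => vP _.
    have [||z Ez] := IHv j.+1; first by case: v vP {IHv}.
      by move=> v0; move: vP; rewrite v0.
    by exists z; rewrite -Ez /=; congr word; elim: (j) => //= i ->.
  have [||z Ez] := IHv 0%N => //; first by case: v vP {IHv}.
  exists (ab_elt j * z); rewrite toHM toH_ab_elt -Ez wordM.
  by rewrite cat_rcons.
by have [||z Ez] := gen 0%N u => //; exists z.
Qed.

Lemma toH_shuffle w w' : toH (shuffle w w') = shuffleH (toH w) (toH w').
Proof.
suff /span_in_toH[y Ey] : span_words nil_or_ends_b (shuffleH (toH w) (toH w')).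
  by rewrite /shuffle Ey toHK.
apply: (span_words_lin (f := shuffleH^~ (toH w')) (P := nil_or_ends_b)).
- exact: bilin_ext_linearl.
- move=> u uP.
  apply: (span_words_lin (f := shuffleH (word u)) (P := nil_or_ends_b)).
  + exact: bilin_ext_linearr.
  + by move=> v vP; rewrite /shuffleH bilin_ext_word; apply: shuffle_nil_or_ends_b.
  + exact: span_toH.
- exact: span_toH.
Qed.

Lemma psi_word ks : psi (word ks) = \prod_(i <- rev ks) psi_gen i.
Proof. exact: lin_ext_word. Qed.

Lemma psi_eh i : psi (eh i) = psi_gen i.
Proof. by rewrite psi_word big_seq1. Qed.

Lemma psi1 : psi 1 = 1.
Proof. by rewrite -word_nil psi_word big_nil word_nil. Qed.

Lemma psiM x y : psi (x * y) = psi y * psi x.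
Proof.
move: x y; apply: (word_eq2 (f := fun x y => psi (x * y))
  (g := fun x y => psi y * psi x)) => [y c x x'|x c y y'|y c x x'|x c y y'|u v].
- by rewrite mulrDl -scalerAl linearP.
- by rewrite mulrDr -malg_scaleAr linearP.
- by rewrite linearP mulrDr -malg_scaleAr.
- by rewrite linearP mulrDl -scalerAl.
by rewrite wordM !psi_word rev_cat big_cat.
Qed.

(* With 'X^i standing for e_(i + 2), psi substitutes - ('X + hbar) for 'X
   (psi_poly), which makes its involutivity visible. *)
Definition poly_eh (p : {poly laurent}) : Hhat1 :=
  \sum_(i < size p) p`_i *: eh (ix i.+2).

Lemma poly_ehEw n (p : {poly laurent}) : (size p <= n)%N ->
  poly_eh p = \sum_(i < n) p`_i *: eh (ix i.+2).
Proof.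
move=> pn; rewrite -(subnKC pn) big_split_ord /= [X in _ + X]big1 ?addr0 //.
by move=> i _; rewrite nth_default ?scale0r // leq_addr.
Qed.

Fact poly_eh_linear : linear poly_eh.
Proof.
move=> c p q; pose n := maxn (size (c *: p + q)) (maxn (size p) (size q)).
rewrite !(@poly_ehEw n) ?leq_max ?leqnn ?orbT // scaler_sumr -big_split /=.
by apply: eq_bigr => i _; rewrite coefD coefZ scalerDl scalerA.
Qed.
HB.instance Definition _ :=
  GRing.isLinear.Build laurent {poly laurent} Hhat1 *:%R poly_eh poly_eh_linear.

Lemma poly_ehX i : poly_eh 'X^i = eh (ix i.+2).
Proof.
rewrite (@poly_ehEw i.+1) ?size_polyXn // (bigD1 ord_max) //=.
rewrite coefXn eqxx scale1r big1 ?addr0 // => j ji.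
by rewrite coefXn (negPf (_ : j != i :> nat)) ?scale0r.
Qed.

Lemma poly_eh_ind (f g : {linear {poly laurent} -> Hhat1}) :
  (forall i, f 'X^i = g 'X^i) -> f =1 g.
Proof.
move=> fg p; rewrite -[p]coefK poly_def !linear_sum; apply: eq_bigr => i _.
by rewrite !linearZ /= fg.
Qed.

Lemma psi_gen_poly i :
  psi_gen (ix i.+2) = poly_eh ((- ('X + hbar%:P)) ^+ i).
Proof.
have -> : (- ('X + hbar%:P)) ^+ i =
    (-1) ^+ i *: \sum_(j < i.+1) ('C(i, j)%:R * hbar ^+ (i - j)) *: 'X^j.
  rewrite ['X + _]addrC [LHS]exprNn exprDn -mul_polyC rmorphXn rmorphN1; congr (_ * _).
  apply: eq_bigr => j _.
  by rewrite -mul_polyC rmorphM rmorph_nat rmorphXn -mulrA mulr_natl.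
rewrite linearZ linear_sum /= -signr_odd /= negbK signr_odd; congr (_ *: _).
rewrite -{1}[2%N]add0n big_addn subSS subSS subn0 big_mkord.
apply: eq_bigr => j _; rewrite linearZ /= poly_ehX !addn2.
by rewrite !subSS !subn0.
Qed.

Lemma psi_poly p :
  psi (poly_eh p) = poly_eh (p \Po (- ('X + hbar%:P))).
Proof.
apply: (@poly_eh_ind (psi \o poly_eh)
  (poly_eh \o comp_poly (- ('X + hbar%:P))) _ p) => i /=.
by rewrite poly_ehX psi_eh psi_gen_poly comp_Xn_poly.
Qed.

Lemma psi_psi_gen i : psi (psi_gen i) = eh i.
Proof.
case: i => [[|i]|].
- by rewrite linearN /= psi_eh opprK.
- rewrite -[Some i.+1]/(ix i.+2) psi_gen_poly psi_poly.
  rewrite -poly_ehX; congr poly_eh.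
  rewrite rmorphXn rmorphN rmorphD /= comp_polyX comp_polyC.
  by rewrite opprD opprK addrK.
- by rewrite linearN /= psi_eh opprK.
Qed.

Lemma psiK : involutive psi.
Proof.
apply: (word_eq (f := psi \o psi) (g := idfun)) => [c x y|//|ks].
  by rewrite /= !linearP.
rewrite /= psi_word; elim: ks => [|i ks IH].
  by rewrite big_nil psi1 word_nil.
by rewrite rev_cons big_rcons /= psiM psi_psi_gen IH wordM.
Qed.

Section ZnTheory.
Variables (F : numFieldType) (n : nat) (zeta : F).
Hypothesis zeta1 : zeta != 1.

Let h0 : 1 - zeta != 0. Proof. by rewrite subr_eq0 eq_sym. Qed.

Let ev : {additive laurent -> F} := HB.pack (laurent_ev (1 - zeta))
  (GRing.isZmodMorphism.Build laurent F _ (laurent_evB h0)).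

Lemma znD : {morph @zn F n zeta : x y / x + y}.
Proof. by move=> x y; apply: (mmapD (f := ev)). Qed.

Lemma znZ c x : @zn F n zeta (c *: x) = laurent_ev (1 - zeta) c * zn n zeta x.
Proof.
rewrite /zn (mmapEw (f := ev) (msuppZ_le c x)) mmapE big_distrr /=.
apply: eq_bigr => k _; rewrite mcoeffZ [X in X * _](laurent_evM h0).
by rewrite -[LHS]mulrA.
Qed.

Lemma zn_word ks : zn n zeta (word ks) = zval n zeta ks.
Proof.
rewrite /zn (mmapU (f := ev)) [X in X * _](laurent_ev1 h0).
exact: mul1r.
Qed.

End ZnTheory.

(* Main.v *)
(** Let [f_m(w)] be the coefficient of [t^m] in the q-polylogarithm of [w]: [b]
    acts on power series as multiplication by [t / (1 - t)] and [a] as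
    [t^m |-> q^m / [m] t^m], a Rota-Baxter operator of weight [hbar = 1 - q].
    Hence the shuffle product becomes the product of power series modulo [t^n],
    and [z_n(w)] is the sum of [f_m(w)] for [m < n]. So [z_n(w sh w')] is the sum
    of [f_i(w) f_j(w')] for [i + j < n]; replacing the summation index [m] of the
    first letter [e_k] of [w] by [n - m] moves that letter to the front of [w'],
    and turns [F_k(m)] into [F_k(n - m)], which is the value of [psi(e_k)] because
    [zeta^n = 1]. The stuffle product is the case analysis on which of the
    largest indices of two nested sums is bigger, by induction on the bound. *)
Require Import Defs.
From HB Require Import structures.
From mathcomp Require Import all_boot all_order all_algebra.
From mathcomp Require Import finmap monalg complex.
From mathcomp Require Import boolp reals.
From mathcomp Require Import ring.

Import Order.TTheory GRing.Theory Num.Theory.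
Local Open Scope ring_scope.

Set Implicit Arguments.
Unset Strict Implicit.

(** * Partial sums and Cauchy products of coefficient sequences *)

Section Convolution.
Variable F : comNzRingType.
Implicit Types (f g : nat -> F) (m : nat).

(** The sum stops before [m], so [psum] is multiplication by t / (1 - t); the strict inequalities
    between summation indices come from it. *)
Definition psum f m : F := \sum_(j < m) f j.

Definition conv f g m : F := \sum_(i < m.+1) f i * g (m - i)%N.

Lemma psum0 f : psum f 0 = 0.
Proof. exact: big_ord0. Qed.

Lemma psumS f m : psum f m.+1 = psum f m + f m.
Proof. exact: big_ord_recr. Qed.

Lemma eq_psum f g m : (forall j, (j < m)%N -> f j = g j) -> psum f m = psum g m.
Proof. by move=> fg; apply: eq_bigr => j _; apply: fg. Qed.

Lemma convC f g m : conv f g m = conv g f m.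
Proof.
rewrite /conv (reindex_inj rev_ord_inj); apply: eq_bigr => i _ /=.
by rewrite subSS subKn -1?ltnS // mulrC.
Qed.

Lemma eq_conv f f' g g' m : (forall i, (i <= m)%N -> f i = f' i) ->
  (forall i, (i <= m)%N -> g i = g' i) -> conv f g m = conv f' g' m.
Proof.
by move=> ff gg; apply: eq_bigr => i _; rewrite ff ?gg ?leq_subr // -ltnS.
Qed.

Lemma conv1 g m : conv (fun i => (i == 0)%:R) g m = g m.
Proof.
rewrite /conv big_ord_recl subn0 mul1r big1 ?addr0 // => i _.
by rewrite mul0r.
Qed.

(** Multiplication by t / (1 - t) can be moved onto either factor of a product of series. *)
Lemma psum_convl f g m : psum (conv f g) m = conv (psum f) g m.
Proof.
elim: m => [|m IH]; first by rewrite psum0 /conv big_ord1 psum0 mul0r.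
rewrite psumS IH [RHS]/conv big_ord_recl psum0 mul0r add0r -big_split /=.
by apply: eq_bigr => i _; rewrite subSS psumS mulrDl.
Qed.

Lemma psum_convr f g m : psum (conv f g) m = conv f (psum g) m.
Proof.
rewrite convC -psum_convl.
by apply: eq_psum => j _; apply: convC.
Qed.

End Convolution.

(** * Series coefficients of words in the two alphabets *)

Section Coefficients.
Variables (F : numFieldType) (zeta : F).
Implicit Types (m : nat).

(** This is the part of the nested sum whose largest index equals [m]; the empty index gives the
    constant series 1. *)
Fixpoint ecoef (ks : seq Nhat) m : F :=
  if ks is k :: ks' then Fq zeta k m * psum (ecoef ks') m else (m == 0)%:R.

Definition acoef m : F := zeta ^+ m / qnat zeta m.

(* [acoef 0] is the junk value 0, so the Rota-Baxter identity holds only on series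
   without constant term, and [abcoef u] is meaningful only for the words [u]
   that do not end with a. *)
Fixpoint abcoef (u : seq bool) m : F :=
  match u with
  | [::] => (m == 0)%:R
  | la :: u' => acoef m * abcoef u' m
  | lb :: u' => psum (abcoef u') m
  end.

Lemma acoef0 : acoef 0 = 0.
Proof. by rewrite /acoef /qnat subrr mul0r invr0 mulr0. Qed.

Lemma abcoef_ends_b u : ends_b u -> abcoef u 0 = 0.
Proof. by case: u => [|[] u] //= _; rewrite ?psum0 // acoef0 mul0r. Qed.

(** * Nested sums as iterated partial sums *)

Section NestedSums.
Variable n : nat.

(** The bound [M] is separate from [n], so that the indices keep their type ['I_n] while the bound
    drops in the recursion. *)
Definition decr_below r M (m : {ffun 'I_r -> 'I_n}) :=
  [forall j, (0 < m j < M)%N] &&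
  [forall i : 'I_r, forall j : 'I_r, (i < j)%N ==> (m j < m i)%N].

Definition zval_below M (ks : seq Nhat) : F :=
  \sum_(m : {ffun 'I_(size ks) -> 'I_n} | decr_below M m)
    \prod_(j < size ks) Fq zeta (nth bar1 ks j) (m j).

Definition ffun_cons r (p : 'I_n * {ffun 'I_r -> 'I_n}) : {ffun 'I_r.+1 -> 'I_n} :=
  [ffun i => if unlift ord0 i is Some j then p.2 j else p.1].

Lemma ffun_cons0 r (p : 'I_n * {ffun 'I_r -> 'I_n}) : ffun_cons p ord0 = p.1.
Proof. by rewrite ffunE unlift_none. Qed.

Lemma ffun_consS r (p : 'I_n * {ffun 'I_r -> 'I_n}) i : ffun_cons p (lift ord0 i) = p.2 i.
Proof. by rewrite ffunE liftK. Qed.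

Lemma ffun_cons_bij r : bijective (@ffun_cons r).
Proof.
exists (fun m : {ffun 'I_r.+1 -> 'I_n} => (m ord0, [ffun i => m (lift ord0 i)])).
  move=> [a m]; rewrite ffun_cons0; congr pair.
  by apply/ffunP => i; rewrite ffunE ffun_consS.
move=> m; apply/ffunP => i; case: (unliftP ord0 i) => [j|] ->.
  by rewrite ffun_consS ffunE.
by rewrite ffun_cons0.
Qed.

(** The first entry is the largest and becomes the bound for the others; their bound by [M] then
    follows by transitivity. *)
Lemma decr_below_cons r M a (m : {ffun 'I_r -> 'I_n}) :
  decr_below M (ffun_cons (a, m)) = (0 < a < M)%N && decr_below a m.
Proof.
apply/idP/idP.
  case/andP=> /forallP bd /forallP dc.
  have := bd ord0; rewrite ffun_cons0 /= => -> /=; apply/andP; split.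
    apply/forallP => j; have := bd (lift ord0 j); rewrite ffun_consS => /andP[-> _].
    by have /forallP/(_ (lift ord0 j)) := dc ord0; rewrite ffun_consS ffun_cons0.
  apply/forallP => i; apply/forallP => j.
  by have /forallP/(_ (lift ord0 j)) := dc (lift ord0 i); rewrite !ffun_consS.
case/and3P=> /andP[a0 aM] /forallP bd /forallP dc; apply/andP; split.
  apply/forallP => i; case: (unliftP ord0 i) => [j|] ->; last first.
    by rewrite ffun_cons0 a0.
  by rewrite ffun_consS; case/andP: (bd j) => -> /ltn_trans->.
apply/forallP => i; apply/forallP => j.
case: (unliftP ord0 j) => [j'|] ->; last by rewrite ltn0.
case: (unliftP ord0 i) => [i'|] ->; rewrite !ffun_consS ?ffun_cons0 /=.
  by have /forallP/(_ j') := dc i'.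
by case/andP: (bd j').
Qed.

Lemma zval_below_cons M k ks :
  zval_below M (k :: ks) =
  \sum_(a < n | (0 < a < M)%N) Fq zeta k a * zval_below a ks.
Proof.
rewrite /zval_below /= (reindex _ (onW_bij _ (ffun_cons_bij (size ks)))) /=.
under [RHS]eq_bigr => a _ do rewrite big_distrr /=.
rewrite pair_big_dep /=; apply: eq_big => [[a m]|[a m] _].
  by rewrite decr_below_cons.
rewrite big_ord_recl ffun_cons0; congr (_ * _).
by apply: eq_bigr => i _; rewrite ffun_consS.
Qed.

Lemma zval_belowE M ks : (0 < M <= n)%N -> zval_below M ks = psum (ecoef ks) M.
Proof.
elim: ks M => [|k ks IH] M /andP[M0 Mn].
  (* There is one function on ['I_0], with empty product 1; since [M > 0], the partial sum contains
     the constant term 1. *)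
  rewrite /zval_below (eq_bigl xpredT) => [|m]; last first.
    by apply/andP; split; apply/forallP => -[].
  rewrite (eq_bigr (fun=> 1)) => [|m _]; last by rewrite big_ord0.
  rewrite sumr_const card_ffun !card_ord expn0 /psum -(prednK M0) big_ord_recl.
  by rewrite big1 ?addr0.
rewrite zval_below_cons /psum (big_ord_widen_cond n xpredT (ecoef (k :: ks))) //.
(* Only the partial sum contains the index 0; its term vanishes because the inner sum is empty. *)
rewrite [RHS](bigID (fun a : 'I_n => (0 < a)%N)) /= [X in _ + X]big1 ?addr0.
  apply: eq_big => [a|a /andP[a0 aM]]; first by rewrite andbC.
  by rewrite IH // a0 ltnW // (leq_trans aM).
by move=> a /andP[_]; rewrite -eqn0Ngt => /eqP->; rewrite psum0 mulr0.
Qed.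

Lemma zvalE ks : (0 < n)%N -> zval n zeta ks = psum (ecoef ks) n.
Proof.
move=> n0; rewrite -zval_belowE ?n0 ?leqnn //; apply: eq_bigl => m.
by congr andb; apply: eq_forallb => j; rewrite ltn_ord andbT.
Qed.

End NestedSums.
End Coefficients.

(** * Functionals that are linear through the evaluation of hbar at 1 - zeta *)

Section Functionals.
Variables (F : numFieldType) (zeta : F).
Hypothesis zeta1 : zeta != 1.

Let h0 : 1 - zeta != 0.
Proof. by rewrite subr_eq0 eq_sym. Qed.

Local Notation ev := (laurent_ev (1 - zeta)).

Let eva : {additive laurent -> F} := HB.pack ev
  (GRing.isZmodMorphism.Build laurent F _ (laurent_evB h0)).

Lemma ev1 : ev 1 = 1. Proof. exact: laurent_ev1. Qed.
Lemma evM : {morph ev : x y / x * y}. Proof. exact: laurent_evM. Qed.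
Lemma evN : {morph ev : x / - x}. Proof. exact: (raddfN eva). Qed.
Lemma ev_nat k : ev k%:R = k%:R.
Proof. by rewrite [LHS](raddfMn eva) [X in X *+ _]ev1. Qed.
Lemma evX x k : ev (x ^+ k) = ev x ^+ k.
Proof. by elim: k => [|k IH]; rewrite ?expr0 ?ev1 // !exprS evM IH. Qed.
Lemma ev_hbar : ev hbar = 1 - zeta. Proof. exact: laurent_ev_hbar. Qed.

Definition ev_linear (I : choiceType) (f : free_alg I -> F) :=
  forall c x y, f (c *: x + y) = ev c * f x + f y.

Definition word_ext (I : choiceType) (phi : seq I -> F) (x : free_alg I) : F :=
  mmap ev (fun u : {fmonom I} => phi u) x.

Section OneAlphabet.
Variable I : choiceType.
Implicit Types (f g : free_alg I -> F).

Lemma word_ext_linear (phi : seq I -> F) : ev_linear (word_ext phi).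
Proof.
move=> c x y; rewrite [LHS](mmapD (f := eva)); congr (_ + _).
rewrite /word_ext (mmapEw (f := eva) (msuppZ_le c x)) mmapE big_distrr /=.
apply: eq_bigr => k _; rewrite mcoeffZ [X in X * _]evM.
by rewrite -[LHS]mulrA.
Qed.

Lemma word_ext_word (phi : seq I -> F) u : word_ext phi (word u) = phi u.
Proof. by rewrite [LHS](mmapU (f := eva)) [X in X * _]ev1 mul1r. Qed.

Lemma ev_linear0 f : ev_linear f -> f 0 = 0.
Proof.
move=> fl; have /esym/eqP := fl 1 0 0.
by rewrite scaler0 addr0 ev1 mul1r -subr_eq0 addrK => /eqP.
Qed.

Lemma ev_linearD f : ev_linear f -> {morph f : x y / x + y}.
Proof. by move=> fl x y; rewrite -[x]scale1r fl ev1 mul1r scale1r. Qed.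

Lemma ev_linearZ f : ev_linear f -> forall c x, f (c *: x) = ev c * f x.
Proof. by move=> fl c x; rewrite -[c *: x]addr0 fl (ev_linear0 fl) addr0. Qed.

Lemma ev_linearN f : ev_linear f -> {morph f : x / - x}.
Proof. by move=> fl x; rewrite -scaleN1r (ev_linearZ fl) evN ev1 mulN1r. Qed.

Lemma ev_linearZM f : ev_linear f ->
  forall c (x y : free_alg I), f ((c *: x) * y) = ev c * f (x * y).
Proof.
move=> fl c x y; rewrite -(ev_linearZ fl); congr f.
exact/esym/scalerAl.
Qed.

Lemma ev_linear_affineM f : ev_linear f ->
  forall c (x y z : free_alg I),
  f ((x + c *: y) * z) = f (x * z) + ev c * f (y * z).
Proof.
by move=> fl c x y z; rewrite mulrDl (ev_linearD fl) (ev_linearZM fl).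
Qed.

Lemma ev_linear_sum f : ev_linear f ->
  forall (J : Type) (r : seq J) (P : pred J) (X : J -> free_alg I),
  f (\sum_(j <- r | P j) X j) = \sum_(j <- r | P j) f (X j).
Proof.
move=> fl J r P X; apply: (big_morph f) => [x y|]; last exact: ev_linear0.
exact: ev_linearD.
Qed.

Lemma ev_linear_mull f a : ev_linear f -> ev_linear (fun x => a * f x).
Proof. by move=> fl c x y; rewrite fl mulrDr mulrCA. Qed.

Lemma ev_linear_psum (f : nat -> free_alg I -> F) m :
  (forall j, ev_linear (f j)) -> ev_linear (fun x => psum (f^~ x) m).
Proof.
move=> fl c x y; rewrite /psum big_distrr -big_split /=.
by apply: eq_bigr => j _; rewrite fl.
Qed.

Lemma ev_linear_comp (J : choiceType) f (g : free_alg J -> free_alg I) :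
  ev_linear f -> linear g -> ev_linear (f \o g).
Proof. by move=> fl gl c x y; rewrite /= gl fl. Qed.

Lemma ev_linear_compM f y : ev_linear f -> ev_linear (fun x => f (y * x)).
Proof. by move=> fl c x x'; rewrite mulrDr -malg_scaleAr fl. Qed.

Lemma ev_linear_eq f g : ev_linear f -> ev_linear g ->
  (forall u, f (word u) = g (word u)) -> f =1 g.
Proof.
move=> fl gl fg; apply: word_ind => [|c u x IH]; first by rewrite !ev_linear0.
by rewrite fl gl fg IH.
Qed.

Lemma ev_linear_eq2 (f g : free_alg I -> free_alg I -> F) :
  (forall y, ev_linear (f^~ y)) -> (forall x, ev_linear (f x)) ->
  (forall y, ev_linear (g^~ y)) -> (forall x, ev_linear (g x)) ->
  (forall u v, f (word u) (word v) = g (word u) (word v)) -> f =2 g.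
Proof.
move=> fl fr gl gr fg x y; apply: (ev_linear_eq (fl y) (gl y)) => u.
exact: (ev_linear_eq (fr _) (gr _)).
Qed.

End OneAlphabet.

(** * Coefficient functionals and their behaviour under a leading letter *)

Definition hcoef m : Hhat1 -> F := word_ext (fun ks => ecoef zeta ks m).

Definition Hcoef m : Halg -> F := word_ext (fun u => abcoef zeta u m).

Lemma hcoef_linear m : ev_linear (hcoef m).
Proof. exact: word_ext_linear. Qed.

Lemma Hcoef_linear m : ev_linear (Hcoef m).
Proof. exact: word_ext_linear. Qed.

Lemma hcoef_word m ks : hcoef m (word ks) = ecoef zeta ks m.
Proof. exact: word_ext_word. Qed.

Lemma Hcoef_word m u : Hcoef m (word u) = abcoef zeta u m.
Proof. exact: word_ext_word. Qed.

Lemma hcoef_ehM m k x : hcoef m (eh k * x) = Fq zeta k m * psum (hcoef^~ x) m.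
Proof.
apply: (ev_linear_eq (f := fun x => hcoef m (eh k * x))
  (g := fun x => Fq zeta k m * psum (hcoef^~ x) m)) x => [||u].
- exact/ev_linear_compM/hcoef_linear.
- by apply/ev_linear_mull/ev_linear_psum => j; apply: hcoef_linear.
rewrite wordM hcoef_word /=; congr (_ * _).
by apply: eq_psum => j _; rewrite hcoef_word.
Qed.

Lemma Hcoef_bM m x : Hcoef m (gen_b * x) = psum (Hcoef^~ x) m.
Proof.
apply: (ev_linear_eq (f := fun x => Hcoef m (gen_b * x))
  (g := fun x => psum (Hcoef^~ x) m)) x => [||u].
- exact/ev_linear_compM/Hcoef_linear.
- by apply/ev_linear_psum => j; apply: Hcoef_linear.
rewrite wordM Hcoef_word /=.
by apply: eq_psum => j _; rewrite Hcoef_word.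
Qed.

Lemma Hcoef_aM m x : Hcoef m (gen_a * x) = acoef zeta m * Hcoef m x.
Proof.
apply: (ev_linear_eq (f := fun x => Hcoef m (gen_a * x))
  (g := fun x => acoef zeta m * Hcoef m x)) x => [||u].
- exact/ev_linear_compM/Hcoef_linear.
- exact/ev_linear_mull/Hcoef_linear.
by rewrite wordM !Hcoef_word.
Qed.

Lemma znE n x : (0 < n)%N -> zn n zeta x = psum (hcoef^~ x) n.
Proof.
move=> n0; apply: (ev_linear_eq (f := zn n zeta)
  (g := fun x => psum (hcoef^~ x) n)) x => [||ks].
- exact: (word_ext_linear (zval n zeta)).
- by apply/ev_linear_psum => j; apply: hcoef_linear.
rewrite zn_word // zvalE //.
by apply: eq_psum => j _; rewrite hcoef_word.
Qed.

Lemma qnat_eq0 m : (qnat zeta m == 0) = (zeta ^+ m == 1).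
Proof. by rewrite mulf_eq0 invr_eq0 (negPf h0) orbF subr_eq0 eq_sym. Qed.

(** With q^m = 1 - hbar [m], the rules for [circ_q] become the expansions of the products F_k(m)
    F_l(m). *)
Lemma hcoef_circM m k l x :
  hcoef m (circ_q k l * x) =
  Fq zeta k m * Fq zeta l m * psum (hcoef^~ x) m.
Proof.
have H := hcoef_linear m.
have circE : hcoef m (circ_q k l * x) =
    match k, l with
    | None, None => Fq zeta (ix 2) m - (1 - zeta) * Fq zeta bar1 m
    | None, Some j | Some j, None => Fq zeta (ix (j.+1 + 1)) m
    | Some i, Some j => Fq zeta (ix (i.+1 + j.+1)) m +
        (1 - zeta) * Fq zeta (ix (i.+1 + j.+1 - 1)) m
    end * psum (hcoef^~ x) m.
  case: k l => [k|] [l|]; last 1 first.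
  - rewrite [circ_q _ _]/(eh (ix 2) - hbar *: eh bar1) -scaleNr.
    rewrite (ev_linear_affineM H) evN.
    rewrite ev_hbar [X in X + _]hcoef_ehM [X in _ + _ * X]hcoef_ehM.
    by rewrite [RHS]mulrBl mulNr mulrA.
  - rewrite [circ_q _ _]/(eh (ix (k.+1 + l.+1)) +
      hbar *: eh (ix (k.+1 + l.+1 - 1))) (ev_linear_affineM H).
    rewrite ev_hbar [X in X + _]hcoef_ehM [X in _ + _ * X]hcoef_ehM.
    by rewrite [RHS]mulrDl mulrA.
  - exact: hcoef_ehM.
  - exact: hcoef_ehM.
rewrite circE; congr (_ * _); rewrite {circE H}.
(* When [m] = 0 both sides vanish, as division by zero gives zero. *)
have [q0|q0] := eqVneq (qnat zeta m) 0.
  have F0 i : Fq zeta i m = 0.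
    by case: i => [i|]; rewrite /= q0 ?expr0n invr0 mulr0.
  by case: k l => [k|] [l|]; rewrite !F0 !mulr0 ?oppr0 ?addr0.
have qE : zeta ^+ m = 1 - (1 - zeta) * qnat zeta m.
  by rewrite /qnat; field.
have zX i : zeta ^+ (i * m) = (zeta ^+ m) ^+ i by rewrite mulnC exprM.
case: k l => [k|] [l|] /=.
- rewrite !addSn !addnS !subn1 /= !zX !exprS !exprD qE.
  by field; rewrite q0 !expf_neq0.
- rewrite addn1 /= !subn1 /= !zX !exprS qE.
  by field; rewrite q0 expf_neq0.
- rewrite addn1 /= !subn1 /= !zX !exprS qE.
  by field; rewrite q0 expf_neq0.
- by rewrite subn1 mul1n qE; field.
Qed.

(** * The stuffle product *)

Lemma psum_hcoef_stuffle_word M u v :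
  psum (hcoef^~ (stuffle_word u v)) M =
  psum (ecoef zeta u) M * psum (ecoef zeta v) M.
Proof.
have hw w N : psum (hcoef^~ (word w)) N = psum (ecoef zeta w) N.
  by apply: eq_psum => j _; rewrite hcoef_word.
elim: M u v => [|M IH] u v; first by rewrite !psum0 mul0r.
have nilE : psum (ecoef zeta [::]) M.+1 = 1.
  by rewrite /psum big_ord_recl big1 ?addr0.
case: u => [|k u]; first by case: v => [|l v]; rewrite nilE mul1r /= hw.
case: v => [|l v]; first by rewrite nilE mulr1 /= hw.
(* The right side is (A + a)(B + b), with a and b the coefficients at [M]. The induction hypothesis
   gives AB; the terms aB, Ab and ab, where the first, the second or both leading indices equal [M],
   match the three terms of the recursion. *)
rewrite psumS IH !(psumS (ecoef _ _)).
have -> : stuffle_word (k :: u) (l :: v) =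
  eh k * stuffle_word u (l :: v) + eh l * stuffle_word (k :: u) v
  + circ_q k l * stuffle_word u v by [].
have hcoefD3 a b c : hcoef M (a + b + c) = hcoef M a + hcoef M b + hcoef M c.
  by rewrite !(ev_linearD (hcoef_linear M)).
rewrite hcoefD3 [X in X + _ + _]hcoef_ehM [X in _ + X + _]hcoef_ehM.
rewrite [X in _ + _ + X]hcoef_circM !IH /=.
by ring.
Qed.

Lemma zn_stuffle n w w' : (0 < n)%N ->
  zn n zeta (stuffle w w') = zn n zeta w * zn n zeta w'.
Proof.
move=> n0; have zl : ev_linear (zn n zeta).
  exact: (word_ext_linear (zval n zeta)).
apply: (ev_linear_eq2 (f := fun w w' => zn n zeta (stuffle w w'))
                        (g := fun w w' => zn n zeta w * zn n zeta w'))
  => [y|x|y|x|u v].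
- by move=> c x x'; rewrite /stuffle bilin_ext_linearl zl.
- by move=> c y y'; rewrite /stuffle bilin_ext_linearr zl.
- by move=> c x x'; rewrite zl mulrDl mulrA.
- exact: ev_linear_mull.
rewrite /stuffle bilin_ext_word !zn_word // !zvalE // znE //.
exact: psum_hcoef_stuffle_word.
Qed.

(** Thus a + hbar acts on the coefficient of t^m as division by [m]. *)
Lemma qnat_inv m : qnat zeta m != 0 ->
  (qnat zeta m)^-1 = 1 - zeta + acoef zeta m.
Proof.
move=> q0; have z0 : 1 - zeta ^+ m != 0.
  by rewrite subr_eq0 eq_sym -qnat_eq0.
by rewrite /acoef /qnat; field; rewrite h0 z0.
Qed.

(** * Agreement of the two alphabets modulo t^n at a primitive root of unity *)

Section RootOfUnity.
Variable n : nat.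
Hypothesis zetaP : n.-primitive_root zeta.

Lemma qnat_neq0 m : (0 < m < n)%N -> qnat zeta m != 0.
Proof.
case/andP=> m0 mn; rewrite qnat_eq0 -(prim_order_dvd zetaP).
by rewrite gtnNdvd.
Qed.

Lemma Hcoef_e_in_HM m k x : (m < n)%N ->
  Hcoef m (e_in_H k * x) = Fq zeta k m * psum (Hcoef^~ x) m.
Proof.
have H := Hcoef_linear m.
move=> mn; case: k => [k|] /=; last by rewrite -mulrA Hcoef_aM Hcoef_bM.
have aX i y : Hcoef m (gen_a ^+ i * y) = acoef zeta m ^+ i * Hcoef m y.
  elim: i => [|i IH]; first by rewrite !expr0 !mul1r.
  by rewrite !exprS -mulrA Hcoef_aM IH mulrA.
rewrite -!mulrA aX (ev_linear_affineM H) [X in X + _]Hcoef_aM.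
rewrite [1 * (_ * _)]mul1r Hcoef_bM ev_hbar -mulrDl !mulrA subn1 /=.
(* At 0, where [m] is not invertible, the empty partial sum makes both sides vanish. *)
case: m mn {H aX} => [|m] mn; first by rewrite psum0 !mulr0.
have q0 : qnat zeta m.+1 != 0 by apply: qnat_neq0.
congr (_ * _); rewrite addrC -qnat_inv // /acoef expr_div_n -mulrA -invfM.
by rewrite -exprSr mulnC exprM.
Qed.

(** This links the letters e_k, in which [zn] is computed, to the letters a and b, in which the
    shuffle is defined. *)
Lemma hcoef_toH m x : (m < n)%N -> hcoef m x = Hcoef m (toH x).
Proof.
move=> mn; apply: (ev_linear_eq (f := hcoef m) (g := Hcoef m \o toH)) x => [||ks].
- exact: hcoef_linear.
- exact: (ev_linear_comp (Hcoef_linear m) toH_linear).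
elim: ks m mn => [|k ks IH] m mn.
  by rewrite word_nil /= toH1 -!word_nil hcoef_word Hcoef_word.
rewrite -[k :: ks]/([:: k] ++ ks) -wordM /= toHM -/(eh k) toH_eh.
rewrite hcoef_ehM Hcoef_e_in_HM //; congr (_ * _).
by apply: eq_psum => j jm; rewrite IH // (ltn_trans jm).
Qed.

(** * The shuffle product as a product of series *)

Lemma acoef_mul i j : (0 < i)%N -> (0 < j)%N -> (i + j < n)%N ->
  acoef zeta i * acoef zeta j =
  acoef zeta (i + j) * (acoef zeta i + acoef zeta j + (1 - zeta)).
Proof.
move=> i0 j0 ijn.
have qi : 1 - zeta ^+ i != 0.
  have : qnat zeta i != 0.
    by apply: qnat_neq0; rewrite i0 (leq_ltn_trans (leq_addr j i)).
  by rewrite qnat_eq0 subr_eq0 eq_sym.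
have qj : 1 - zeta ^+ j != 0.
  have : qnat zeta j != 0.
    by apply: qnat_neq0; rewrite j0 (leq_ltn_trans (leq_addl i j)).
  by rewrite qnat_eq0 subr_eq0 eq_sym.
have qij : 1 - zeta ^+ i * zeta ^+ j != 0.
  have : qnat zeta (i + j) != 0 by apply: qnat_neq0; rewrite addn_gt0 i0.
  by rewrite qnat_eq0 subr_eq0 eq_sym exprD.
rewrite /acoef /qnat exprD.
by field; rewrite h0 qi qj qij.
Qed.

(** The Rota-Baxter identity of weight 1 - zeta, obtained termwise from [acoef_mul]. The zero
    constant terms dispose of the end indices, where [acoef] takes its junk value. *)
Lemma conv_acoef (f g : nat -> F) m : f 0%N = 0 -> g 0%N = 0 -> (m < n)%N ->
  conv (fun i => acoef zeta i * f i) (fun i => acoef zeta i * g i) m =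
  acoef zeta m * (conv (fun i => acoef zeta i * f i) g m
    + conv f (fun i => acoef zeta i * g i) m + (1 - zeta) * conv f g m).
Proof.
move=> f0 g0 mn; rewrite /conv [_ * \sum_(i < _) (f i * _)]big_distrr.
rewrite -!big_split big_distrr /=; apply: eq_bigr => i _.
have [->|i0] := posnP i; first by rewrite f0 !(mul0r, mulr0, addr0).
have [->|j0] := posnP (m - i)%N; first by rewrite g0 !(mul0r, mulr0, addr0).
have im : (i <= m)%N by rewrite -ltnS.
have := acoef_mul i0 j0; rewrite subnKC // => /(_ mn) E.
rewrite mulrACA E.
by ring.
Qed.

(** A leading b is a factor t / (1 - t), which moves through the product; two leading a's are the
    Rota-Baxter identity. The condition on the words ensures that what follows a leading a has no
    constant term. *)
Lemma Hcoef_shuffle_word u v m : nil_or_ends_b u -> nil_or_ends_b v ->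
  (m < n)%N ->
  Hcoef m (shuffle_word u v) = conv (abcoef zeta u) (abcoef zeta v) m.
Proof.
have tail b w : nil_or_ends_b (b :: w) -> nil_or_ends_b w by case: w => //= c w.
have H := Hcoef_linear.
elim: u v m => [|c u IHu]; elim=> [|d v IHv] m uP vP mn.
- by rewrite conv1 Hcoef_word.
- by rewrite conv1 Hcoef_word.
- rewrite convC conv1.
  have -> : shuffle_word (c :: u) [::] = word (c :: u) by case: (c).
  by rewrite Hcoef_word.
have lt_n j : (j < m)%N -> (j < n)%N by move=> jm; apply: ltn_trans mn.
case: c uP IHv => uP IHv; last first.
  rewrite [shuffle_word _ _]/(gen_b * shuffle_word u (d :: v)) Hcoef_bM.
  rewrite -[RHS]psum_convl; apply: eq_psum => j /lt_n jn.
  exact: IHu (tail _ _ uP) vP jn.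
case: d vP => vP; last first.
  rewrite [shuffle_word _ _]/(gen_b * shuffle_word (la :: u) v) Hcoef_bM.
  rewrite -[RHS]psum_convr; apply: eq_psum => j /lt_n jn.
  exact: IHv uP (tail _ _ vP) jn.
rewrite [shuffle_word _ _]/(gen_a * (shuffle_word (la :: u) v +
  shuffle_word u (la :: v) + hbar *: shuffle_word u v)).
rewrite Hcoef_aM !(ev_linearD (H m)) (ev_linearZ (H m)) ev_hbar.
rewrite IHv ?IHu ?(tail _ _ uP) ?(tail _ _ vP) //.
have eb w : nil_or_ends_b (la :: w) -> abcoef zeta w 0 = 0.
  by case: w => // b w wP; apply: abcoef_ends_b.
exact/esym/(conv_acoef (eb _ uP) (eb _ vP) mn).
Qed.

Lemma linear_fun0 (A : pzRingType) (U V : lmodType A) (f : U -> V) :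
  linear f -> f 0 = 0.
Proof.
by move=> /(_ 1 0 0)/eqP; rewrite scaler0 addr0 scale1r eq_sym -subr_eq0 addrK => /eqP.
Qed.

(** Bilinear extension, carried out inside the span of the words that are empty or end with b. *)
Lemma Hcoef_shuffleH x y m :
  span_words nil_or_ends_b x -> span_words nil_or_ends_b y -> (m < n)%N ->
  Hcoef m (shuffleH x y) = conv (Hcoef^~ x) (Hcoef^~ y) m.
Proof.
move=> xP yP mn; have H := Hcoef_linear.
have conv0r f : conv f (Hcoef^~ (0 : Halg)) m = 0.
  by rewrite /conv big1 // => i _; rewrite (ev_linear0 (H _)) mulr0.
have convDr f c u z : conv f (Hcoef^~ (c *: word u + z)) m =
    ev c * conv f (Hcoef^~ (word u)) m + conv f (Hcoef^~ z) m.
  rewrite /conv big_distrr -big_split; apply: eq_bigr => i _ /=.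
  by rewrite H; ring.
elim: xP => [|c u z uP _ IH].
  rewrite convC conv0r -[RHS](ev_linear0 (H m)).
  by congr (Hcoef m); apply: linear_fun0 (bilin_ext_linearl shuffle_word y).
have -> : shuffleH (c *: word u + z) y = c *: shuffleH (word u) y + shuffleH z y.
  exact: bilin_ext_linearl.
rewrite [LHS](H m) [X in _ + X]IH [RHS]convC [RHS]convDr; congr (_ * _ + _);
  last exact: convC.
rewrite convC {z IH}; elim: yP => [|d v z vP _ IH].
  rewrite conv0r -[RHS](ev_linear0 (H m)).
  by congr (Hcoef m); apply: linear_fun0 (bilin_ext_linearr shuffle_word (word u)).
have -> : shuffleH (word u) (d *: word v + z) =
    d *: shuffleH (word u) (word v) + shuffleH (word u) z.
  exact: bilin_ext_linearr.
rewrite [LHS](H m) [X in _ + X]IH [RHS]convDr [shuffleH (word u) (word v)]bilin_ext_word.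
rewrite Hcoef_shuffle_word //.
congr (_ * _ + _); apply: eq_conv => i _; by rewrite Hcoef_word.
Qed.

Lemma zn_shuffle_conv w w' :
  zn n zeta (shuffle w w') = psum (conv (hcoef^~ w) (hcoef^~ w')) n.
Proof.
rewrite znE ?(prim_order_gt0 zetaP) //; apply: eq_psum => m mn.
rewrite hcoef_toH // toH_shuffle Hcoef_shuffleH //; try exact: span_toH.
by apply: eq_conv => i im; rewrite hcoef_toH // (leq_ltn_trans im).
Qed.

(** * The reflection of m into n - m and the map [psi] *)

Lemma qnat_sub m : (m <= n)%N ->
  qnat zeta (n - m) = - qnat zeta m / zeta ^+ m.
Proof.
move=> mn; have zm : zeta ^+ m != 0.
  by rewrite expf_neq0 // (prim_root_eq0 zetaP) -lt0n (prim_order_gt0 zetaP).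
rewrite /qnat -mulNr mulrAC; congr (_ / _).
apply: (mulIf zm); rewrite mulfVK // mulrBl -exprD subnK //.
by rewrite (prim_expr_order zetaP) mul1r opprB.
Qed.

(** Since [n - m] = - [m] / q^m, the reflection exchanges F_1 and F_(bar1) up to sign, and F_k(n -
    m) = (-1)^k q^m / [m]^k for k at least 2; expanding the latter in the F_j(m) gives the
    coefficients of [psi_gen]. *)
Lemma hcoef_psi_genM m k x : (m < n)%N ->
  hcoef m (psi_gen k * x) = Fq zeta k (n - m) * psum (hcoef^~ x) m.
Proof.
move=> mn; have H := hcoef_linear m.
case: m mn H => [|m'] mn H.
  rewrite psum0 mulr0; case: k => [[|k]|] /=.
  - by rewrite mulNr (ev_linearN H) hcoef_ehM psum0 mulr0 oppr0.
  - rewrite (ev_linearZM H) mulr_suml (ev_linear_sum H) big1 ?mulr0 //.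
    by move=> j _; rewrite (ev_linearZM H) hcoef_ehM psum0 !mulr0.
  - by rewrite mulNr (ev_linearN H) hcoef_ehM psum0 mulr0 oppr0.
move: mn H; set m := m'.+1 => mn H.
have q0 : qnat zeta m != 0 by exact: qnat_neq0.
have zm : zeta ^+ m != 0.
  by rewrite expf_neq0 // (prim_root_eq0 zetaP) -lt0n (prim_order_gt0 zetaP).
have znm : zeta ^+ (n - m) = (zeta ^+ m)^-1.
  apply: (mulIf zm); rewrite mulVf // -exprD subnK 1?ltnW //.
  exact: prim_expr_order.
case: k => [[|k]|] /=; rewrite ?qnat_sub 1?ltnW //.
- rewrite mulNr (ev_linearN H) hcoef_ehM /= -mulNr; congr (_ * _).
  by rewrite subnn !mul0n !expr0; field; rewrite q0 zm.
(* In this case the index is the integer [k + 2], so the binomial exponent is [k]. *)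
- rewrite (ev_linearZM H) mulr_suml (ev_linear_sum H).
  under eq_bigr => j _ do rewrite (ev_linearZM H) hcoef_ehM mulrA.
  rewrite -mulr_suml mulrA; congr (_ * _).
  rewrite evX evN ev1 -{1}[2%N]add0n big_addn subSS subSS subn0 big_mkord.
  (* the binomial theorem for [1 / [m] = q^m / [m] + hbar] *)
  transitivity ((-1) ^+ k.+2 * (zeta ^+ m / qnat zeta m ^+ 2 *
                                (qnat zeta m)^-1 ^+ k)).
    congr (_ * _); rewrite (qnat_inv q0) exprDn big_distrr /=.
    apply: eq_bigr => j _; rewrite addn2 evM ev_nat evX ev_hbar !subSS !subn0 /=.
    rewrite mulSn exprD [(j * m)%N]mulnC exprM /acoef -[in RHS]mulr_natl.
    move: (qnat zeta m) (zeta ^+ m) q0 => Q Z q0; rewrite expr_div_n !exprS.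
    by field; rewrite q0 expf_neq0.
  rewrite [(k.+1 * _)%N]mulnC exprM znm.
  move: (qnat zeta m) (zeta ^+ m) q0 zm => Q Z q0 zm.
  rewrite expr_div_n [(- Q) ^+ _]exprNn !exprVn !exprS -signr_odd.
  by case: (odd k); field; rewrite q0 zm !expf_neq0.
- rewrite mulNr (ev_linearN H) hcoef_ehM /= -mulNr; congr (_ * _).
  by rewrite subnn mul0n expr0 expr1 znm; field; rewrite q0 zm.
Qed.

(** The letters of [ks] move one by one to the front of the second factor, first letter first, which
    is why [psi] reverses words. The induction needs [x] arbitrary because [x] absorbs the moved
    letters. *)
Lemma psum_conv_psi_word ks x :
  psum (conv (hcoef^~ (word ks)) (hcoef^~ x)) n =
  psum (hcoef^~ (psi (word ks) * x)) n.
Proof.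
elim: ks x => [|k ks IH] x.
  rewrite psi_word big_nil mul1r; apply: eq_psum => m _.
  by rewrite -[RHS](conv1 (hcoef^~ x)); apply: eq_conv => i _ //; rewrite hcoef_word.
rewrite -[k :: ks]/([:: k] ++ ks) -wordM psiM -mulrA -IH psi_eh.
(* The outer sum is absorbed by [x] on the left and by [ks] on the right. Both sides become sums
   over [i] of F_k(i) times the partial sum of [ks] below [i] and that of [x] below [n - i]; the
   term [i = 0], outside the range of the reflection, is zero. *)
rewrite psum_convr [RHS]psum_convl; apply: eq_bigr => i _.
rewrite hcoef_ehM.
have [->|i0] := posnP i; first by rewrite !psum0 mulr0 !mul0r.
have nin : (n - i < n)%N by rewrite ltn_subrL i0 (prim_order_gt0 zetaP).
by rewrite (hcoef_psi_genM _ _ nin) subKn -1?ltnS // mulrCA mulrA.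
Qed.

Lemma zn_shuffle w w' : zn n zeta (shuffle w w') = zn n zeta (psi w * w').
Proof.
rewrite zn_shuffle_conv znE ?(prim_order_gt0 zetaP) //.
apply: (ev_linear_eq (f := fun w => psum (conv (hcoef^~ w) (hcoef^~ w')) n)
                       (g := fun w => psum (hcoef^~ (psi w * w')) n)) w => [||ks].
- apply: ev_linear_psum => m c x y; rewrite /conv big_distrr -big_split /=.
  by apply: eq_bigr => i _; rewrite hcoef_linear mulrDl mulrA.
- apply: ev_linear_psum => m c x y.
  by rewrite psi_linear mulrDl -scalerAl hcoef_linear.
exact: psum_conv_psi_word.
Qed.

End RootOfUnity.
End Functionals.

Unset Implicit Arguments.

Theorem theorem4p2 (R : realType) (n : nat) (zeta : R[i])
    (hn : (2 <= n)%N) (hzeta : n.-primitive_root zeta) :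
  (forall w w' : Hhat1,
     zn n zeta (stuffle w w') = zn n zeta w * zn n zeta w') /\
  (forall w w' : Hhat1,
     zn n zeta (shuffle w w') = zn n zeta (psi w * w')).
Proof.
(* As the order is at least 2, hbar acts by a nonzero scalar, so that hbar^-1 can be evaluated. *)
have zeta1 : zeta != 1.
  by rewrite -[zeta]expr1 -(prim_order_dvd hzeta) gtnNdvd.
split=> w w'; first by apply: zn_stuffle; rewrite // ltnW.
exact: zn_shuffle.
Qed.
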